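(* Let $\Gamma=(V,E)$ be an undirected graph with $V=\{1,\dots,N\}$ and consider the multi-agent system of $N$ agents in $\mathbb{R}^n$, $$\dot X=\sum_{(i,j)\in E}u_{ij}A_{ij}X,\qquad X(0)=X_0,$$ where $X\in\mathbb{R}^{N\times n}$ is the matrix whose $i$th row is the (transposed) state $x_i'$ of agent $i$, and $u_{ij}=u_{ji}$ are piecewise constant real controls. This system is controllable on $\mathbb{P}$ if and only if $\tilde\iota(\mathcal{F})=[(1,\dots,N)]$, where $\mathcal{F}=\{A_{ij}:(i,j)\in E\}$.
   Context: $e_i$ is the $i$th standard basis vector of $\mathbb{R}^N$, $'$ denotes transpose, and $A_{ij}=e_ie_j'+e_je_i'-e_ie_i'-e_je_j'\in\mathbb{R}^{N\times N}$; thus the system reads $\dot x_i=\sum_{j:(i,j)\in E}u_{ij}(x_j-x_i)$. The nondegenerate configuration space (state space) $\mathbb{P}$ is the set of $(x_1,\dots,x_N)\in(\mathbb{R}^n)^N$ with $\sum_{i=1}^N x_i=0$, $x_i\ne x_j$ for all $i\ne j$, and $\mathrm{span}\{x_1-x_2,\dots,x_1-x_N\}=\mathbb{R}^n$. Controllable on $\mathbb{P}$ means that for every $X_0,X_1\in\mathbb{P}$ there are controls steering the system from $X_0$ to $X_1$ in finite time. $S_N$ is the symmetric group on $\{1,\dots,N\}$ with operation ''$\cdot$''. For $\sigma,\eta\in S_N$, $\sigma\sim\eta$ iff they have the same orbits on $\{1,\dots,N\}$; $[\sigma]$ is the class of $\sigma$. For transpositions, $\sigma*\eta=\sigma$ if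 $\sigma=\eta$ and $\sigma*\eta=\sigma\cdot\eta$ otherwise. More generally, for $\sigma\in S_N$ and a transposition $\tau=(i,j)$, $\sigma*\tau=\sigma$ if $i,j$ lie in the same orbit of $\sigma$, and $\sigma*\tau=\sigma\cdot\tau$ otherwise; a product $\sigma*\eta$ is obtained by writing $\eta$ as a product of a minimal number of transpositions and applying this rule successively. This induces a commutative, associative operation $[\sigma]*[\eta]=[\sigma*\eta]$ on $S_N/\!\sim$. For a set of matrices $A_{ij}$ with $i\neq j$, $\tilde\iota(\{A_{a_1b_1},\dots,A_{a_lb_l}\})=[(a_1,b_1)*\cdots*(a_l,b_l)]$, where $(a,b)$ is the transposition exchanging $a$ and $b$, and $\tilde\iota(\varnothing)=[e]$, $e$ the identity.
   Formalization: Assumes n ≥ 1 and N > n+1: for N = n+1 ≥ 2 the sign of det(x_1−x_2,…,x_1−x_N) is invariant, so connected graphs are not controllable; for 2 ≤ N ≤ n (or n = 0, N ≥ 2) P is empty and controllability is vacuous. The trivial N ≤ 1 is dropped. *)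

(* Defs.v *)
From mathcomp Require Import all_boot all_order all_algebra all_fingroup zify.
From mathcomp Require Import all_classical all_reals all_analysis.

Set Implicit Arguments.
Unset Strict Implicit.
Unset Printing Implicit Defensive.

Import Order.TTheory GRing.Theory Num.Theory.
Import numFieldNormedType.Exports.

Local Open Scope classical_set_scope.
Local Open Scope ring_scope.

(* Agents are numbered by 'I_N, that is,
   from 0; the state of the system is the N x n matrix whose rows are the
   positions of the agents. *)

(* delta_mx i j is e_i e_j'. *)
Definition Amx (R : realType) (N : nat) (i j : 'I_N) : 'M[R]_N :=
  delta_mx i j + delta_mx j i - delta_mx i i - delta_mx j j.

Definition edge_matrices (R : realType) (N : nat) (e : rel 'I_N) :
    set 'M[R]_N :=
  [set M | exists i j, e i j /\ M = Amx R i j].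
Arguments edge_matrices R [N] e.

(* The values at the switching times are unconstrained. *)
Definition piecewise_constant (R : realType) (T : R) (f : R -> R) : Prop :=
  exists2 s : seq R, itv_partition 0 T s &
    forall k, (k < size s)%N ->
      exists c, forall t,
        nth 0 (0 :: s) k < t < nth 0 (0 :: s) k.+1 -> f t = c.

Definition admissible_control (R : realType) (N : nat) (T : R)
    (u : 'I_N -> 'I_N -> R -> R) : Prop :=
  (forall i j, u i j = u j i) /\ (forall i j, piecewise_constant T (u i j)).

(* An edge {i, j} contributes one term, indexed by i < j. *)
Definition vector_field (R : realType) (N n : nat) (e : rel 'I_N)
    (u : 'I_N -> 'I_N -> R) (X : 'M[R]_(N, n)) : 'M[R]_(N, n) :=
  \sum_(i : 'I_N) \sum_(j : 'I_N | (i < j)%N && e i j) u i j *: (Amx R i j *m X).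

(* Solutions are continuous and satisfy the equation off a finite set, since
   the controls jump. *)
Definition trajectory (R : realType) (N n : nat) (e : rel 'I_N) (T : R)
    (u : 'I_N -> 'I_N -> R -> R) (X : R -> 'M[R]_(N, n)) : Prop :=
  (forall i k, {within `[0, T], continuous (fun t => X t i k)}) /\
  exists D : seq R, forall t, 0 < t < T -> t \notin D ->
    forall i k,
      is_derive t (1 : R) (fun t => X t i k)
        (vector_field e (fun i j => u i j t) (X t) i k).

Definition steers (R : realType) (N n : nat) (e : rel 'I_N)
    (X0 X1 : 'M[R]_(N, n)) : Prop :=
  exists (T : R) (u : 'I_N -> 'I_N -> R -> R) (X : R -> 'M[R]_(N, n)),
    [/\ 0 <= T, admissible_control T u, trajectory e T u X, X 0 = X0 & X T = X1].

(* In the span condition, "forall i1, val i1 = 0" names the first agent. *)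
Definition configuration_space (R : realType) (N n : nat) : set 'M[R]_(N, n) :=
  [set X | [/\ \sum_i row i X = 0,
               forall i j, i != j -> row i X != row j X &
               forall i1 : 'I_N, val i1 = 0%N ->
                 <<[seq row i1 X - row j X | j in predC1 i1]>>%VS
                   = {: 'rV[R]_n}%VS ]].
Arguments configuration_space : clear implicits.

Definition controllable_on (R : realType) (N n : nat) (e : rel 'I_N)
    (P : set 'M[R]_(N, n)) : Prop :=
  forall X0 X1, P X0 -> P X1 -> steers e X0 X1.

Definition same_orbits (N : nat) (s t : 'S_N) : bool := porbits s == porbits t.

Definition perm_class (N : nat) (s : 'S_N) : {set 'S_N} :=
  [set t | same_orbits s t]%SET.

(* s * (i, j).  The library composes permutations from left to right; the
   opposite order gives the same class, as both merge the orbits of i and j. *)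
Definition star_tperm (N : nat) (s : 'S_N) (p : 'I_N * 'I_N) : 'S_N :=
  if p.2 \in porbit s p.1 then s else (s * tperm p.1 p.2)%g.

(* (a_1, b_1) * ... * (a_l, b_l), associated to the left.  Starting from the
   identity is harmless, as 1 * (a, b) = (a, b) when a != b, and it gives the
   identity for the empty product. *)
Definition star_prod (N : nat) (ps : seq ('I_N * 'I_N)) : 'S_N :=
  foldl (@star_tperm N) 1%g ps.

(* The set F is enumerated through its index pairs a < b, in a fixed order;
   iota_tildeE below shows that any other enumeration gives the same class. *)
Definition iota_tilde (R : realType) (N : nat) (F : set 'M[R]_N) :
    {set 'S_N} :=
  perm_class (star_prod
    [seq p : 'I_N * 'I_N <- enum {: 'I_N * 'I_N} | (p.1 < p.2)%N && `[< F (Amx R p.1 p.2) >]]).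

(* The cycle (1, ..., N), sending each i to i + 1 modulo N. *)
Definition long_cycle (N : nat) : 'S_N := perm (@ordS_inj N).

Lemma AmxC (R : realType) (N : nat) (i j : 'I_N) : Amx R i j = Amx R j i.
Proof.
by rewrite /Amx [delta_mx i j + _]addrC -!addrA [- delta_mx i i + _]addrC.
Qed.

Lemma Amx_inj (R : realType) (N : nat) (a b c d : 'I_N) :
  a != b -> c != d -> Amx R a b = Amx R c d ->
  (a, b) = (c, d) \/ (a, b) = (d, c).
Proof.
move=> ab cd /matrixP /(_ a b); rewrite !mxE !eqxx /=.
have -> : (b == a) = false by rewrite eq_sym (negbTE ab).
rewrite (negbTE ab) /= !subr0 addr0.
have -> : (a == c) && (b == c) = false.
  by apply/negP => /andP[/eqP ac /eqP bc]; rewrite ac bc eqxx in ab.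
have -> : (a == d) && (b == d) = false.
  by apply/negP => /andP[/eqP ac /eqP bc]; rewrite ac bc eqxx in ab.
rewrite !subr0; case: (boolP ((a == c) && (b == d))) => [/andP[/eqP-> /eqP->]|_].
  by left.
case: (boolP ((a == d) && (b == c))) => [/andP[/eqP-> /eqP->]|_]; first by right.
by rewrite addr0 => /eqP; rewrite oner_eq0.
Qed.

Lemma star_tperm_mem (N : nat) (s : 'S_N) (p : 'I_N * 'I_N) :
  p.2 \in porbit (star_tperm s p) p.1.
Proof.
rewrite /star_tperm; case: ifPn => //; case: p => i j /= nij.
have -> : (s * tperm i j)%g = ((tperm i j * s^-1)^-1)%g.
  by rewrite invMg invgK tpermV.
rewrite porbitV; set s' := (tperm i j * s^-1)%g.
have ij : i != j by apply: contraNneq nij => ->; exact: porbit_id.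
have h1 := porbits_mul_tperm s^-1 i j; have h2 := porbits_mul_tperm s' i j.
move: h1 h2; rewrite /= -/s' {2}/s' tpermKg porbitV ij porbit_sym nij.
rewrite porbit_sym; case: (j \in porbit s' i) => //= h1 h2.
move: h1 h2; set a := #|_|; set b := #|_| => h1 h2.
lia.
Qed.

Lemma star_tperm_step (N : nat) (s : 'S_N) (p : 'I_N * 'I_N) (x : 'I_N) :
  s x \in porbit (star_tperm s p) x.
Proof.
have := star_tperm_mem s p; rewrite /star_tperm.
case: ifPn => _; first by move=> _; exact: (mem_porbit s 1).
set s' := (s * _)%g => pP.
have s'x : s' x \in porbit s' x by exact: (mem_porbit s' 1).
have -> : s x = tperm p.1 p.2 (s' x) by rewrite permM tpermK.
case: tpermP => [e|e|//] ; rewrite e in s'x.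
- by move: s'x; rewrite -!eq_porbit_mem in pP * => /eqP <-.
- by move: s'x; rewrite -!eq_porbit_mem in pP * => /eqP <-; rewrite eq_sym.
Qed.

Lemma star_prod_min (N : nat) (E : rel 'I_N) (ps : seq ('I_N * 'I_N)) :
  reflexive E -> symmetric E -> transitive E ->
  (forall p, p \in ps -> E p.1 p.2) ->
  forall x y, y \in porbit (star_prod ps) x -> E x y.
Proof.
move=> Er Es Et psE.
suff step x : E x (star_prod ps x).
  move=> x y /porbitP[k ->]; elim: k => [|k IHk]; first by rewrite perm1 Er.
  by rewrite expgSr permM (Et _ _ _ IHk).
have : forall x, E x ((1%g : 'S_N) x) by move=> z; rewrite perm1.
rewrite /star_prod; move: 1%g x psE; elim: ps => [|p ps IHps] s x psE sE //=.
apply: IHps => [q qps|z]; first by rewrite psE // inE qps orbT.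
rewrite /star_tperm; case: ifP => // _; rewrite permM.
apply: (Et _ _ _ (sE z)); have pE : E p.1 p.2 by rewrite psE // mem_head.
by case: tpermP => [->|->|//] //; rewrite Es.
Qed.

Lemma star_prod_mem (N : nat) (ps : seq ('I_N * 'I_N)) (p : 'I_N * 'I_N) :
  p \in ps -> p.2 \in porbit (star_prod ps) p.1.
Proof.
have mono (q : 'I_N * 'I_N) (s : 'S_N) x y : y \in porbit s x -> y \in porbit (star_tperm s q) x.
  move=> /porbitP[k ->]; elim: k => [|k]; first by rewrite perm1 porbit_id.
  rewrite -eq_porbit_mem => /eqP <-; rewrite expgSr permM.
  exact: star_tperm_step.
have foldmono qs s x y :
    y \in porbit s x -> y \in porbit (foldl (@star_tperm N) s qs) x.
  by elim: qs s => //= q qs IHqs s /(mono q)/IHqs.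
rewrite /star_prod; elim: ps 1%g => // q ps IHps s.
rewrite inE => /orP[/eqP->|]; last exact: IHps.
by apply: (foldmono ps); exact: star_tperm_mem.
Qed.

Lemma star_prod_class (N : nat) (ps qs : seq ('I_N * 'I_N)) :
  (forall p, p \in ps -> (p \in qs) || ((p.2, p.1) \in qs)) ->
  (forall p, p \in qs -> (p \in ps) || ((p.2, p.1) \in ps)) ->
  perm_class (star_prod ps) = perm_class (star_prod qs).
Proof.
have sub (ps1 ps2 : seq ('I_N * 'I_N)) :
    (forall p, p \in ps1 -> (p \in ps2) || ((p.2, p.1) \in ps2)) ->
    forall x y, y \in porbit (star_prod ps1) x -> y \in porbit (star_prod ps2) x.
  move=> s12; apply: (@star_prod_min _ (fun x y => y \in porbit (star_prod ps2) x)).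
  - by move=> x; exact: porbit_id.
  - by move=> x y; exact: porbit_sym.
  - by move=> y x z; rewrite -!eq_porbit_mem => /eqP -> /eqP ->.
  - by move=> p /s12 /orP[/star_prod_mem //|/star_prod_mem /=]; rewrite porbit_sym.
move=> /sub pq /sub qp; apply/setP => t; rewrite !inE /same_orbits.
congr (_ == _); apply: eq_imset => x; apply/setP => y.
by apply/idP/idP => [/pq|/qp].
Qed.

Lemma iota_tildeE (R : realType) (N : nat) (F : set 'M[R]_N)
    (ps : seq ('I_N * 'I_N)) :
  (forall p, p \in ps -> p.1 != p.2) ->
  F = [set M | exists2 p, p \in ps & M = Amx R p.1 p.2] ->
  iota_tilde F = perm_class (star_prod ps).
Proof.
move=> neq ->; apply: star_prod_class => -[i j].
  rewrite mem_filter => /andP[/andP[/= ij /asboolP[[a b] /= abps eqA]] _].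
  have nij : i != j by apply: contraTneq ij => ->; rewrite ltnn.
  by case: (Amx_inj nij (neq _ abps) eqA) => -[-> ->]; rewrite abps ?orbT.
move=> ijps; have /= := neq _ ijps.
rewrite mem_filter mem_enum mem_filter mem_enum /= !andbT neq_ltn => /orP[] ij.
  by rewrite ij /=; apply/orP; left; apply/asboolP; exists (i, j).
rewrite ij /=; apply/orP; right; apply/asboolP; exists (i, j) => //.
by rewrite AmxC.
Qed.

(* Main.v *)
Require Import Defs.
From mathcomp Require Import all_boot all_order all_algebra all_fingroup.
From mathcomp Require Import all_classical all_reals all_analysis.
From mathcomp Require Import ring lra.

(** The class of the product of all edges is the class of the long cycle
exactly when the graph is connected: the star product of a list of
transpositions has as orbits the connected components of the graph they draw
([iota_tilde_connected]).  So the theorem says: controllable iff connected.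

Necessity.  Every edge term moves its two agents by opposite amounts, hence
the sum of the positions over a connected component is constant along
trajectories ([steers_component_sum]).  Two configurations on the moment curve
t |-> (t, t^2, ..., t^n), one of them with a single parameter moved, have
different sums over any proper component ([controllable_connected]).

Sufficiency.  Write v = e_i - e_j for an edge.  Holding the control of that
edge constant and the others at 0 multiplies x_i - x_j by an arbitrary positive
factor and fixes the midpoint: this is the dilation 1 + s v v' with s > -1/2
([can_dilate_edge]).  The proof computes with explicit words in the group
generated by these dilations.

- Two edges ij and jk.  With v = e_i - e_j and w = e_j - e_k, a dilation along
  w conjugated by a dilation along v, and a dilation along v conjugated by one
  along w, can be given the same direction 2v - w.  The product of the first
  with factor l and the second with factor 1/l fixes that direction
  and has determinant 1: it is a shear, and all shears along 2v - w arise
  so ([shear_of_dilations]).  Exchanging i and k gives the shears along another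
  direction, and the two families generate SL_2 of the plane spanned by v and w.
- SL_2 contains the rotation permuting the three agents cyclically, which
  conjugates dilations along jk into dilations along ik ([can_dilate_trans]).
  As the graph is connected, dilations along all pairs become available.
- SL_2 also contains the shears along e_i - e_j with functional
  x_i + x_j - 2 x_k ([root_shear]).  Combining them over all k while the
  positions add up to 0, one gets x_i += c x_l together with x_N -= c x_l
  ([row_op_reach]): on the first N - 1 rows, which determine the last one, these
  are the elementary row operations.
- Elementary row operations carry any matrix with N - 1 rows and n < N - 1
  independent columns to any other ([elementary_transitive]): there is always a
  spare row, so that pivots can be normalized to 1 without scaling a row. *)

Set Implicit Arguments.
Unset Strict Implicit.
Unset Printing Implicit Defensive.

Import Order.TTheory GRing.Theory Num.Theory.
Import numFieldNormedType.Exports.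

Local Open Scope classical_set_scope.
Local Open Scope ring_scope.

(** * Dilations and shears *)

(** Defined through the controls steering to X, rather than as [steers e X Y]:
then transitivity is immediate, and a basic move has only to be appended to a
given trajectory.  It implies [steers e X Y], as X is steered to itself. *)
Definition reach (R : realType) (N n : nat) (e : rel 'I_N)
    (X Y : 'M[R]_(N, n)) : Prop :=
  forall X0, steers e X0 X -> steers e X0 Y.

Lemma reach_trans (R : realType) (N n : nat) (e : rel 'I_N)
    (Y X Z : 'M[R]_(N, n)) : reach e X Y -> reach e Y Z -> reach e X Z.
Proof. by move=> XY YZ X0 /XY/YZ. Qed.

(** The matrix 1 + s v v' with v = e_i - e_j, applied to X; as v'v = 2, it
multiplies x_i - x_j by 1 + 2 s. *)
Definition dilation (R : realType) (N n : nat) (i j : 'I_N) (s : R)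
    (X : 'M[R]_(N, n)) : 'M[R]_(N, n) :=
  \matrix_(l, m) (X l m + s * ((l == i)%:R - (l == j)%:R) * (X i m - X j m)).

Definition vec3 (R : realType) (a b c : R) : R * R * R := (a, b, c).

(** The matrix 1 + c d h' applied to X, where d and h are supported on i, j, k
and have there the coordinates listed.  It is a shear when h'd = 0. *)
Definition shear (R : realType) (N n : nat) (i j k : 'I_N)
    (d h : R * R * R) (c : R) (X : 'M[R]_(N, n)) : 'M[R]_(N, n) :=
  \matrix_(l, m) (X l m
    + c * (d.1.1 * (l == i)%:R + d.1.2 * (l == j)%:R + d.2 * (l == k)%:R)
        * (h.1.1 * X i m + h.1.2 * X j m + h.2 * X k m)).

(** The bound is the condition 1 + 2 s > 0: the factor of a dilation is an
exponential. *)
Definition can_dilate (R : realType) (N : nat) (e : rel 'I_N) (i j : 'I_N) :=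
  forall n (s : R) (X : 'M[R]_(N, n)), - 2^-1 < s -> reach e X (dilation i j s X).
Arguments can_dilate R [N] e i j.

Definition can_shear (R : realType) (N : nat) (e : rel 'I_N) (i j k : 'I_N)
    (d h : R * R * R) :=
  forall n (c : R) (X : 'M[R]_(N, n)), reach e X (shear i j k d h c X).
Arguments can_shear R [N] e i j k d h.

Lemma reach_dilation (R : realType) (N n : nat) (e : rel 'I_N) (i j : 'I_N)
    (s : R) (X Y : 'M[R]_(N, n)) : can_dilate R e i j -> - 2^-1 < s ->
  reach e X Y -> reach e X (dilation i j s Y).
Proof. by move=> Dij s0 XY; apply: reach_trans XY _; exact: Dij. Qed.

Lemma reach_shear (R : realType) (N n : nat) (e : rel 'I_N) (i j k : 'I_N) d h
    (c : R) (X Y : 'M[R]_(N, n)) : can_shear R e i j k d h ->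
  reach e X Y -> reach e X (shear i j k d h c Y).
Proof. by move=> S XY; apply: reach_trans XY _; exact: S. Qed.

Lemma can_dilateC (R : realType) (N : nat) (e : rel 'I_N) (i j : 'I_N) :
  can_dilate R e i j -> can_dilate R e j i.
Proof.
move=> Dij n s X s0.
have -> : dilation j i s X = dilation i j s X; last exact: Dij.
by apply/matrixP => l m; rewrite !mxE; ring.
Qed.

Section Triangle.
Variables (R : realType) (N : nat) (e : rel 'I_N).
Implicit Types i j k : 'I_N.

(** In both conjugates below the direction is q = 2 (e_i - e_j) - (e_j - e_k):
the dilation of ratio 5 along e_i - e_j maps e_j - e_k to - q, and the dilation
of ratio 2 along e_j - e_k maps e_i - e_j to q / 2.  The functional of a
conjugate is the image of the old one under the inverse transpose. *)
Lemma conj_dilation_jk n i j k (s : R) (X : 'M[R]_(N, n)) :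
  i != j -> j != k -> i != k ->
  dilation i j 2 (dilation j k s (dilation i j (- 2 / 5) X)) =
  shear i j k (vec3 2 (-3) 1) (vec3 2 3 (-5)) (- s / 5) X.
Proof.
move=> ij jk ik.
pose E := (eqxx, negbTE ij, negbTE jk, negbTE ik,
  eq_sym j i, eq_sym k i, eq_sym k j).
by apply/matrixP => a m; rewrite !mxE /vec3 /= !E /=; field.
Qed.

Lemma conj_dilation_ij n i j k (s : R) (X : 'M[R]_(N, n)) :
  i != j -> j != k -> i != k ->
  dilation j k 2^-1 (dilation i j s (dilation j k (- 4^-1) X)) =
  shear i j k (vec3 2 (-3) 1) (vec3 4 (-3) (-1)) (s / 8) X.
Proof.
move=> ij jk ik.
pose E := (eqxx, negbTE ij, negbTE jk, negbTE ik,
  eq_sym j i, eq_sym k i, eq_sym k j).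
by apply/matrixP => a m; rewrite !mxE /vec3 /= !E /=; field.
Qed.

(** If f and g are the functionals of the two conjugates, normalized to take the
value 1 on q, then (1 + (l - 1) q f') (1 + (1/l - 1) q g') =
1 + (l - 1) q (f - g)', and f - g vanishes on q; it is proportional to
(4, 1, -5). *)
Lemma shear_of_dilations i j k : i != j -> j != k -> i != k ->
  can_dilate R e i j -> can_dilate R e j k ->
  can_shear R e i j k (vec3 2 (-3) 1) (vec3 4 1 (-5)).
Proof.
move=> ij jk ik Dij Djk n c X.
pose E := (eqxx, negbTE ij, negbTE jk, negbTE ik,
  eq_sym j i, eq_sym k i, eq_sym k j).
have reachP (s : R) (Y Z : 'M[R]_(N, n)) : - 2^-1 < s -> reach e Y Z ->
    reach e Y (shear i j k (vec3 2 (-3) 1) (vec3 2 3 (-5)) (- s / 5) Z).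
  move=> s0 YZ; rewrite -conj_dilation_jk //.
  apply: (reach_dilation Dij); first lra.
  by apply: (reach_dilation Djk) => //; apply: (reach_dilation Dij) => //; lra.
have reachQ (s : R) (Y Z : 'M[R]_(N, n)) : - 2^-1 < s -> reach e Y Z ->
    reach e Y (shear i j k (vec3 2 (-3) 1) (vec3 4 (-3) (-1)) (s / 8) Z).
  move=> s0 YZ; rewrite -conj_dilation_ij //.
  apply: (reach_dilation Djk); first lra.
  by apply: (reach_dilation Dij) => //; apply: (reach_dilation Djk) => //; lra.
(* The two factors have dilation ratios l and 1/l, or 1/l and l; with l >= 1
   their product is a shear with coefficient 9/80 (l - 1) of either sign. *)
set l := 1 + 80 / 9 * `|c|.
have l1 : 1 <= l by rewrite /l; have := normr_ge0 c; lra.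
have l0 : l != 0 by lra.
have il0 : 0 < l^-1 by rewrite invr_gt0; lra.
have [c0|c0] := lerP 0 c.
  have -> : c = 9 / 80 * (l - 1) by rewrite /l ger0_norm //; lra.
  suff -> : shear i j k (vec3 2 (-3) 1) (vec3 4 1 (-5)) (9 / 80 * (l - 1)) X =
      shear i j k (vec3 2 (-3) 1) (vec3 4 (-3) (-1)) ((l - 1) / 2 / 8)
      (shear i j k (vec3 2 (-3) 1) (vec3 2 3 (-5)) (- ((l^-1 - 1) / 2) / 5) X).
    by apply: reachQ; [lra|apply: reachP => //; lra].
  by apply/matrixP => a m; rewrite !mxE /vec3 /= !E /=; field.
have -> : c = - (9 / 80 * (l - 1)) by rewrite /l ltr0_norm //; lra.
suff -> : shear i j k (vec3 2 (-3) 1) (vec3 4 1 (-5)) (- (9 / 80 * (l - 1))) X =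
    shear i j k (vec3 2 (-3) 1) (vec3 2 3 (-5)) (- ((l - 1) / 2) / 5)
    (shear i j k (vec3 2 (-3) 1) (vec3 4 (-3) (-1)) ((l^-1 - 1) / 2 / 8) X).
  by apply: reachP; [lra|apply: reachQ => //; lra].
by apply/matrixP => a m; rewrite !mxE /vec3 /= !E /=; field.
Qed.

Definition rotate3 n i j k (X : 'M[R]_(N, n)) : 'M[R]_(N, n) :=
  \matrix_(l, m) (if l == i then X k m else if l == j then X i m
                   else if l == k then X j m else X l m).

(** The shears along q = (2, -3, 1) and along r = (1, -3, 2) are the upper and
lower unitriangular matrices in the basis (q, r), and a matrix of determinant
1 with nonzero lower left entry is a product upper * lower * upper.  The
coefficients are those of this factorization for the rotation. *)
Lemma rotate3_reach i j k : i != j -> j != k -> i != k ->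
  can_dilate R e i j -> can_dilate R e j k ->
  forall n (X : 'M[R]_(N, n)), reach e X (rotate3 i j k X).
Proof.
move=> ij jk ik Dij Djk n X.
have T := shear_of_dilations ij jk ik Dij Djk.
have T' : can_shear R e k j i (vec3 2 (-3) 1) (vec3 4 1 (-5)).
  by apply: shear_of_dilations; rewrite 1?eq_sym //; exact: can_dilateC.
pose E := (eqxx, negbTE ij, negbTE jk, negbTE ik,
  eq_sym j i, eq_sym k i, eq_sym k j).
suff -> : rotate3 i j k X = shear i j k (vec3 2 (-3) 1) (vec3 4 1 (-5)) (2 / 63)
    (shear k j i (vec3 2 (-3) 1) (vec3 4 1 (-5)) (7 / 27)
    (shear i j k (vec3 2 (-3) 1) (vec3 4 1 (-5)) (- 11 / 63) X)).
  by apply: (reach_shear _ T); apply: (reach_shear _ T'); exact: T.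
apply/matrixP => a m; rewrite !mxE /vec3 /= !E /=.
case: (eqVneq a i) => [->|_]; first by rewrite !E /=; field.
case: (eqVneq a j) => [->|_]; first by rewrite !E /=; field.
case: (eqVneq a k) => [->|_]; first by rewrite /=; field.
by field.
Qed.

(** The rotation maps e_j - e_k to e_k - e_i and is orthogonal, so it conjugates
dilations along jk to dilations along ik.  Its inverse is its square. *)
Lemma can_dilate_trans i j k : i != j -> j != k -> i != k ->
  can_dilate R e i j -> can_dilate R e j k -> can_dilate R e i k.
Proof.
move=> ij jk ik Dij Djk n s X s0.
pose E := (eqxx, negbTE ij, negbTE jk, negbTE ik,
  eq_sym j i, eq_sym k i, eq_sym k j).
have rot := rotate3_reach ij jk ik Dij Djk.
suff -> : dilation i k s X = rotate3 i j k
    (dilation j k s (rotate3 i j k (rotate3 i j k X))).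
  apply: reach_trans (rot _ _); apply: (reach_dilation Djk) => //.
  by apply: reach_trans (rot _ _); exact: rot.
apply/matrixP => a m; rewrite !mxE /vec3 /= !E /=.
case: (eqVneq a i) => [->|_]; first by rewrite ?E /=; ring.
case: (eqVneq a j) => [->|_]; first by rewrite ?E /=; ring.
case: (eqVneq a k) => [->|_]; first by rewrite ?E /=; ring.
by ring.
Qed.

(** Again the factorization upper * lower * upper in the basis (q, r); the
outer factors do not depend on c, and are inverse to each other as the product
is 1 for c = 0. *)
Lemma root_shear i j k : i != j -> j != k -> i != k ->
  can_dilate R e i j -> can_dilate R e j k ->
  can_shear R e i j k (vec3 1 (-1) 0) (vec3 1 1 (-2)).
Proof.
move=> ij jk ik Dij Djk n c X.
have T := shear_of_dilations ij jk ik Dij Djk.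
have T' : can_shear R e k j i (vec3 2 (-3) 1) (vec3 4 1 (-5)).
  by apply: shear_of_dilations; rewrite 1?eq_sym //; exact: can_dilateC.
pose E := (eqxx, negbTE ij, negbTE jk, negbTE ik,
  eq_sym j i, eq_sym k i, eq_sym k j).
suff -> : shear i j k (vec3 1 (-1) 0) (vec3 1 1 (-2)) c X =
    shear i j k (vec3 2 (-3) 1) (vec3 4 1 (-5)) (2 / 9)
    (shear k j i (vec3 2 (-3) 1) (vec3 4 1 (-5)) (- c / 9)
    (shear i j k (vec3 2 (-3) 1) (vec3 4 1 (-5)) (- 2 / 9) X)).
  by apply: (reach_shear _ T); apply: (reach_shear _ T'); exact: T.
by apply/matrixP => a m; rewrite !mxE /vec3 /= !E /=; field.
Qed.
End Triangle.

(** * Row operations on centred configurations *)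

(** Shears with the same direction e_i - e_j compose by adding their functionals,
since the direction is killed by all these functionals. *)
Lemma root_shears_reach (R : realType) (N n : nat) (e : rel 'I_N)
    (i j : 'I_N) (s : seq 'I_N) (w : 'I_N -> R) (X : 'M[R]_(N, n)) :
  (forall a b, a != b -> can_dilate R e a b) -> i != j ->
  (forall k, k \in s -> (k != i) && (k != j)) ->
  reach e X (\matrix_(a, b) (X a b + ((a == i)%:R - (a == j)%:R)
               * \sum_(k <- s) w k * (X i b + X j b - 2 * X k b))).
Proof.
move=> De ij; elim: s X => [|k s IHs] X sP.
  rewrite [X in reach _ _ X](_ : _ = X) //.
  by apply/matrixP => a b; rewrite mxE big_nil mulr0 addr0.
have /andP[ki kj] := sP k (mem_head k s).
have ik : i != k by rewrite eq_sym.
have jk : j != k by rewrite eq_sym.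
have S := root_shear ij jk ik (De _ _ ij) (De _ _ jk).
apply: reach_trans (S _ (w k) X) _.
have /IHs IH a : a \in s -> (a != i) && (a != j).
  by move=> as_; apply: sP; rewrite inE as_ orbT.
set Y := shear _ _ _ _ _ _ _.
rewrite [X in reach _ _ X](_ : _ = \matrix_(a, b) (Y a b
  + ((a == i)%:R - (a == j)%:R)
    * \sum_(k0 <- s) w k0 * (Y i b + Y j b - 2 * Y k0 b))); first exact: IH.
apply/matrixP => a b; rewrite !mxE big_cons.
under [in RHS]eq_big_seq => c cs.
  have /andP[ci cj] : (c != i) && (c != j) by apply: sP; rewrite inE cs orbT.
  rewrite !mxE /vec3 /= !eqxx (negbTE ij) (negbTE ik) (negbTE jk).
  rewrite (eq_sym j i) (negbTE ij) (negbTE ci) (negbTE cj).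
  rewrite (_ : w c * _ = w c * (X i b + X j b - 2 * X c b)); last by ring.
  over.
by rewrite /vec3 /=; ring.
Qed.

(** Configurations with centroid 0 are determined by all positions but the
last. *)
Definition close_up (R : realType) (m n : nat) (Y : 'M[R]_(m, n)) :
    'M[R]_(m.+1, n) :=
  \matrix_(i, b) if unlift ord_max i is Some i' then Y i' b
                 else - \sum_a Y a b.

Lemma close_up_lift (R : realType) (m n : nat) (Y : 'M[R]_(m, n)) i b :
  close_up Y (lift ord_max i) b = Y i b.
Proof. by rewrite mxE liftK. Qed.

Lemma close_up_max (R : realType) (m n : nat) (Y : 'M[R]_(m, n)) b :
  close_up Y ord_max b = - \sum_a Y a b.
Proof. by rewrite mxE unlift_none. Qed.

Lemma sum_ord_lift (V : zmodType) (m : nat) (F : 'I_m.+1 -> V) :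
  \sum_k F k = \sum_(i < m) F (lift ord_max i) + F ord_max.
Proof.
rewrite big_ord_recr /=; congr (_ + _); apply: eq_bigr => i _.
by congr F; apply: val_inj; rewrite /= /bump leqNgt ltn_ord.
Qed.

Lemma close_up_sum (R : realType) (m n : nat) (Y : 'M[R]_(m, n)) b :
  \sum_k close_up Y k b = 0.
Proof.
rewrite sum_ord_lift close_up_max; apply/eqP; rewrite subr_eq0; apply/eqP.
by apply: eq_bigr => i _; rewrite close_up_lift.
Qed.

Lemma row_opE (R : realType) (m n : nat) (i l : 'I_m) (c : R)
    (Y : 'M[R]_(m, n)) a b :
  ((1%:M + c *: delta_mx i l) *m Y) a b = Y a b + (a == i)%:R * (c * Y l b).
Proof.
rewrite mulmxDl mul1mx -scalemxAl !mxE (bigD1 l) //= mxE eqxx andbT.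
rewrite big1 ?addr0; first by ring.
by move=> k /negbTE kl; rewrite mxE kl andbF mul0r.
Qed.

(** When the positions add up to 0, the functionals S - 2 x_k, where
S = x_i + x_last, add up to (m + 1) S over all k; the terms k = i and k = last,
for which no shear is available, cancel out.  So a multiple of their sum
cancels the S in c/2 (2 x_l - S), and leaves c x_l. *)
Lemma row_op_reach (R : realType) (m n : nat) (e : rel 'I_m.+1) (i l : 'I_m)
    (c : R) (Y : 'M[R]_(m, n)) :
  (forall a b, a != b -> can_dilate R e a b) -> i != l ->
  reach e (close_up Y) (close_up ((1%:M + c *: delta_mx i l) *m Y)).
Proof.
move=> De il.
pose i' := lift ord_max i; pose l' := lift ord_max l.
have i'max : i' != ord_max by rewrite eq_sym neq_lift.
have l'max : l' != ord_max by rewrite eq_sym neq_lift.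
have i'l' : i' != l' by rewrite (inj_eq lift_inj).
pose s := [seq k <- index_enum 'I_m.+1 | (k != i') && (k != ord_max)].
(* The weight of the functional S - 2 x_k. *)
pose w k : R := c / (2 * m.+1%:R) - (k == l')%:R * (c / 2).
have sP k : k \in s -> (k != i') && (k != ord_max).
  by rewrite mem_filter => /andP[].
suff -> : close_up ((1%:M + c *: delta_mx i l) *m Y) =
    \matrix_(a, b) (close_up Y a b + ((a == i')%:R - (a == ord_max)%:R)
      * \sum_(k <- s) w k
          * (close_up Y i' b + close_up Y ord_max b - 2 * close_up Y k b)).
  exact: root_shears_reach.
apply/matrixP => a b; rewrite [RHS]mxE.
have -> : \sum_(k <- s) w k * (close_up Y i' b + close_up Y ord_max b
      - 2 * close_up Y k b) = c * Y l b.
  rewrite big_filter.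
  set S := close_up Y i' b + close_up Y ord_max b.
  transitivity (\sum_k w k * (S - 2 * close_up Y k b)).
    rewrite [RHS](bigID (fun k => (k != i') && (k != ord_max))) /=.
    rewrite [X in _ = _ + X](_ : _ = 0) ?addr0 //.
    rewrite (bigD1 i') ?eqxx //= (bigD1 ord_max) /=; last first.
      by rewrite eqxx andbF /= eq_sym.
    rewrite big1 ?addr0 => [|k]; last first.
      by rewrite negb_and !negbK -andbA; case: (k == i') => //=; case: (k == _).
    rewrite /w /S (negbTE i'l') (eq_sym ord_max) (negbTE l'max).
    by ring.
  transitivity (c / (2 * m.+1%:R) * \sum_k (S - 2 * close_up Y k b)
     - c / 2 * (S - 2 * close_up Y l' b)).
    rewrite mulr_sumr [LHS](eq_bigr (fun k =>
        c / (2 * m.+1%:R) * (S - 2 * close_up Y k b)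
        + - ((k == l')%:R * (c / 2 * (S - 2 * close_up Y k b))))); last first.
      by move=> k _; rewrite /w; ring.
    rewrite big_split /= sumrN; congr (_ - _).
    rewrite (bigD1 l') //= eqxx mul1r big1 ?addr0 // => k /negbTE ->.
    by rewrite mul0r.
  rewrite big_split /= sumr_const card_ord sumrN -mulr_sumr close_up_sum.
  rewrite [close_up Y l' b]mxE liftK -[S *+ _]mulr_natr.
  have : m.+1%:R != 0 :> R by rewrite pnatr_eq0.
  move: (m.+1%:R : R) => M M0. by field.
case: (unliftP ord_max a) => [a'|] ->; last first.
  rewrite eqxx eq_sym (negbTE i'max) sub0r mulN1r close_up_max.
  rewrite close_up_max; under eq_bigr do rewrite row_opE.
  rewrite big_split /= opprD; congr (_ - _).
  rewrite (bigD1 i) //= eqxx mul1r big1 ?addr0 // => k /negbTE ->.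
  by rewrite mul0r.
rewrite !close_up_lift row_opE (inj_eq lift_inj) (eq_sym _ ord_max).
by rewrite (negbTE (neq_lift _ _)) subr0.
Qed.

(** * Transitivity of elementary row operations *)

Inductive elementary_product (F : fieldType) (m : nat) : 'M[F]_m -> Prop :=
| ElementaryOne : elementary_product 1%:M
| ElementaryStep (i l : 'I_m) (c : F) (E : 'M[F]_m) : i != l ->
    elementary_product E ->
    elementary_product ((1%:M + c *: delta_mx i l) *m E).

Section ElementaryProducts.
Variable F : fieldType.

Lemma elementaryM m (A B : 'M[F]_m) :
  elementary_product A -> elementary_product B -> elementary_product (A *m B).
Proof.
elim=> [|i l c E il _ IHE] B_el; first by rewrite mul1mx.
by rewrite -mulmxA; apply: ElementaryStep => //; exact: IHE.
Qed.

Lemma elementary1 m (i l : 'I_m) (c : F) : i != l ->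
  elementary_product (1%:M + c *: delta_mx i l).
Proof.
by move=> il; rewrite -[_ + _]mulmx1; apply: ElementaryStep => //; constructor.
Qed.

Lemma elementary_inv m (A : 'M[F]_m) : elementary_product A ->
  exists2 B, elementary_product B & B *m A = 1%:M.
Proof.
elim=> [|i l c E il _ [B B_el BE]].
  by exists 1%:M; [constructor|rewrite mul1mx].
exists (B *m (1%:M + (- c) *: delta_mx i l)).
  by apply: elementaryM => //; exact: elementary1.
rewrite -mulmxA (mulmxA _ _ E) mulmxDl mulmxDr !mul1mx mulmxDr mulmx1.
rewrite -scalemxAl -scalemxAr mul_delta_mx_cond eq_sym (negbTE il) mulr0n.
by rewrite !scaler0 addr0 scaleNr addrK mul1mx.
Qed.

Lemma elementary_dr m (A : 'M[F]_m) : elementary_product A ->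
  elementary_product (block_mx 1%:M 0 0 A : 'M[F]_(1 + m)).
Proof.
elim=> [|i l c E il _ IHE]; first by rewrite -scalar_mx_block; constructor.
rewrite (_ : block_mx _ _ _ _ =
  (1%:M + c *: delta_mx (rshift 1 i) (rshift 1 l)) *m block_mx 1%:M 0 0 E).
  exact: ElementaryStep.
rewrite (_ : 1%:M + _ = block_mx 1%:M 0 0 (1%:M + c *: delta_mx i l)).
  by rewrite mulmx_block !mul1mx !mul0mx !mulmx0 !addr0 !add0r.
apply/matrixP => a b; case: (split_ordP a) => a' ->; case: (split_ordP b) => b' ->.
- by rewrite block_mxEul !mxE !eq_lrshift !eq_lshift /= mulr0 addr0.
- by rewrite block_mxEur !mxE !eq_lrshift /= mulr0 addr0.
- by rewrite block_mxEdl !mxE !eq_rlshift !eq_lrshift andbF /= mulr0 addr0.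
- by rewrite block_mxEdr !mxE !eq_rshift.
Qed.

Lemma elementary_ur m (r : 'rV[F]_m) :
  elementary_product (block_mx 1%:M r 0 1%:M : 'M[F]_(1 + m)).
Proof.
rewrite [r]matrix_sum_delta big_ord1.
elim/big_rec: _ => [|j s _ IHs]; first by rewrite -scalar_mx_block; constructor.
rewrite (_ : block_mx _ _ _ _ =
  (1%:M + r 0 j *: delta_mx (lshift m 0) (rshift 1 j)) *m block_mx 1%:M s 0 1%:M).
  by apply: ElementaryStep => //; rewrite eq_lrshift.
rewrite (_ : 1%:M + _ = block_mx 1%:M (r 0 j *: delta_mx 0 j) 0 1%:M).
  rewrite mulmx_block !mul1mx !mul0mx !mulmx0 !mulmx1 !addr0 !add0r.
  by rewrite [s + _]addrC.
apply/matrixP => a b; case: (split_ordP a) => a' ->; case: (split_ordP b) => b' ->.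
- by rewrite block_mxEul !mxE !eq_lshift !eq_lrshift andbF mulr0 addr0.
- by rewrite block_mxEur !mxE !eq_lrshift !eq_lshift eq_rshift add0r.
- by rewrite block_mxEdl !mxE !eq_rlshift /= mulr0 addr0.
- by rewrite block_mxEdr !mxE !eq_rshift !eq_rlshift mulr0 addr0.
Qed.

Lemma elementary_dl m (c : 'cV[F]_m) :
  elementary_product (block_mx 1%:M 0 c 1%:M : 'M[F]_(1 + m)).
Proof.
rewrite [c]matrix_sum_delta exchange_big big_ord1.
elim/big_rec: _ => [|j s _ IHs]; first by rewrite -scalar_mx_block; constructor.
rewrite (_ : block_mx _ _ _ _ =
  (1%:M + c j 0 *: delta_mx (rshift 1 j) (lshift m 0)) *m block_mx 1%:M 0 s 1%:M).
  by apply: ElementaryStep => //; rewrite eq_rlshift.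
rewrite (_ : 1%:M + _ = block_mx 1%:M 0 (c j 0 *: delta_mx j 0) 1%:M).
  by rewrite mulmx_block !mul1mx !mul0mx !mulmx0 !mulmx1 !addr0 add0r.
apply/matrixP => a b; case: (split_ordP a) => a' ->; case: (split_ordP b) => b' ->.
- by rewrite block_mxEul !mxE !eq_lshift !eq_lrshift mulr0 addr0.
- by rewrite block_mxEur !mxE !eq_lrshift /= mulr0 addr0.
- by rewrite block_mxEdl !mxE !eq_rlshift !eq_lshift eq_rshift add0r.
- by rewrite block_mxEdr !mxE !eq_rshift !eq_rlshift andbF mulr0 addr0.
Qed.

(** Making the corner entry equal to 1 takes a nonzero entry below it; the second
row gets one, by adding the first row, if its own entry is 0 and the corner is not. *)
Lemma elementary_pivot m n (X : 'M[F]_(2 + m, 1 + n)) :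
  (exists i, X i 0 != 0) ->
  exists2 E, elementary_product E & (E *m X) 0 0 = 1.
Proof.
have opE (i l : 'I_(2 + m)) c (Y : 'M[F]_(2 + m, 1 + n)) a :
    ((1%:M + c *: delta_mx i l) *m Y) a 0 = Y a 0 + (a == i)%:R * (c * Y l 0).
  rewrite mulmxDl mul1mx -scalemxAl !mxE (bigD1 l) //= mxE eqxx andbT.
  rewrite big1 ?addr0; first by ring.
  by move=> k /negbTE kl; rewrite mxE kl andbF mul0r.
have below (Y : 'M[F]_(2 + m, 1 + n)) l : 0 != l -> Y l 0 != 0 ->
    exists2 E, elementary_product E & (E *m Y) 0 0 = 1.
  move=> l0 Yl; exists (1%:M + ((1 - Y 0 0) / Y l 0) *: delta_mx 0 l).
    exact: elementary1.
  by rewrite opE eqxx mul1r divfK // addrC subrK.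
move=> [l Xl]; have [l0|l0] := eqVneq 0 l; last exact: below Xl.
have [X1|X1] := eqVneq (X 1 0) 0; last by apply: below X1.
have [|E E_el EX] := below ((1%:M + 1 *: delta_mx 1 0) *m X) 1 isT.
  by rewrite opE eqxx X1 l0 add0r !mul1r.
exists (E *m (1%:M + 1 *: delta_mx 1 0)); last by rewrite -mulmxA.
by apply: elementaryM => //; exact: elementary1.
Qed.

Lemma pid_mx_succ m n :
  block_mx 1%:M 0 0 (pid_mx n) = pid_mx n.+1 :> 'M[F]_(1 + m, 1 + n).
Proof.
apply/matrixP => i j; case: (split_ordP i) => i' ->; case: (split_ordP j) => j' ->.
- by rewrite block_mxEul !mxE !ord1.
- by rewrite block_mxEur !mxE !ord1.
- by rewrite block_mxEdl !mxE !ord1.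
- by rewrite block_mxEdr !mxE /= eqSS ltnS.
Qed.

(** Gaussian elimination by columns.  The hypothesis n < m persists when the
first row and column are removed, so that a matrix with pivot to be found always
has at least two rows, as [elementary_pivot] demands. *)
Lemma elementary_reduce m n (X : 'M[F]_(m, n)) : (n < m)%N ->
  (forall c : 'cV_n, X *m c = 0 -> c = 0) ->
  exists2 E, elementary_product E & E *m X = pid_mx n.
Proof.
elim: n m X => [|n IHn] [|[|m]] X // nm Xinj.
- by exists 1%:M; [constructor|rewrite mul1mx; apply/matrixP => i []].
- by exists 1%:M; [constructor|rewrite mul1mx; apply/matrixP => i []].
have Xinj1 E : elementary_product E ->
    forall c : 'cV_n.+1, E *m X *m c = 0 -> c = 0.
  move=> /elementary_inv[B _ BE] c /(congr1 (mulmx B)).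
  by rewrite mulmx0 !mulmxA BE mul1mx; exact: Xinj.
have [E1 E1_el E1X] : exists2 E, elementary_product E & (E *m X) 0 0 = 1.
  apply: (@elementary_pivot m n X); apply/existsP; rewrite -negb_forall.
  apply/negP => /forallP X0.
  have /Xinj/matrixP/(_ 0 0)/eqP : X *m delta_mx 0 0 = 0 :> 'cV_m.+2.
    apply/matrixP => i j; rewrite -colE mxE [RHS]mxE; exact/eqP.
  by rewrite !mxE eqxx oner_eq0.
have ul1 (W : 'M[F]_(1 + m.+1, 1 + n)) : ulsubmx W = (W 0 0)%:M.
  apply/matrixP => i j; rewrite !ord1 !mxE eqxx.
  by congr (W _ _); exact: val_inj.
pose Z : 'M[F]_(1 + m.+1, 1 + n) := E1 *m X.
pose E2 : 'M[F]_(1 + m.+1) := block_mx 1%:M 0 (- dlsubmx Z) 1%:M.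
pose r := ursubmx Z; pose Z' := drsubmx Z - dlsubmx Z *m r.
have E2Z : E2 *m Z = block_mx 1%:M r 0 Z'.
  rewrite -{1}[Z]submxK /E2 mulmx_block !mul1mx !mul0mx !addr0.
  by rewrite ul1 E1X mulmx1 addNr mulNmx addrC.
have Z'inj (c : 'cV_n) : Z' *m c = 0 -> c = 0.
  move=> Z'c.
  have : E2 *m Z *m (col_mx (- (r *m c)) c : 'cV_(1 + n)) = 0.
    by rewrite E2Z mul_block_col mul1mx addNr mul0mx add0r Z'c col_mx0.
  rewrite /Z mulmxA => /(Xinj1 _ (elementaryM (elementary_dl _) E1_el)).
  by move=> /(congr1 (@dsubmx _ 1 n 1)); rewrite col_mxKd linear0.
have [E E_el EZ] := IHn _ Z' nm Z'inj.
pose E3 : 'M[F]_(1 + m.+1) := block_mx 1%:M 0 0 E.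
(* Row combinations of the reduced block clear the rest of the first row. *)
pose E4 : 'M[F]_(1 + m.+1) :=
  block_mx 1%:M (- (r *m (pid_mx n : 'M[F]_(n, m.+1)))) 0 1%:M.
have E4Z : E4 *m (E3 *m (E2 *m Z)) = block_mx 1%:M 0 0 (pid_mx n).
  rewrite E2Z /E3 /E4 !mulmx_block.
  rewrite !mul1mx !mul0mx !mulmx0 ?mulmx1 !add0r !addr0 EZ.
  rewrite !mulNmx -!mulmxA !mulmx0 oppr0 addr0.
  by rewrite (pid_mx_id _ _ _ (@ltnW n m.+1 nm)) pid_mx_1 mulmx1 subrr.
exists (E4 *m (E3 *m (E2 *m E1))).
  apply: elementaryM; first exact: elementary_ur.
  apply: elementaryM; first exact: elementary_dr.
  by apply: elementaryM => //; exact: elementary_dl.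
by rewrite -!mulmxA [LHS]E4Z pid_mx_succ.
Qed.

Lemma elementary_transitive m n (X Y : 'M[F]_(m, n)) : (n < m)%N ->
  (forall c : 'cV_n, X *m c = 0 -> c = 0) ->
  (forall c : 'cV_n, Y *m c = 0 -> c = 0) ->
  exists2 E, elementary_product E & E *m X = Y.
Proof.
move=> nm /(elementary_reduce nm)[A A_el AX] /(elementary_reduce nm)[B B_el BY].
have [C C_el CB] := elementary_inv B_el.
exists (C *m A); first exact: elementaryM.
by rewrite -mulmxA AX -BY mulmxA CB mul1mx.
Qed.
End ElementaryProducts.

(** * The configuration space *)

Section Configurations.
Variable R : realType.

(** A column killed by X defines a linear form that vanishes on all rows, hence
on the space spanned by their differences. *)
Lemma span_inj (N n : nat) (i1 : 'I_N) (X : 'M[R]_(N, n)) :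
  <<[seq row i1 X - row j X | j in predC1 i1]>>%VS = {: 'rV[R]_n}%VS ->
  forall c : 'cV_n, X *m c = 0 -> c = 0.
Proof.
move=> Ufull c Xc0.
have /span_subvP sub : {subset [seq row i1 X - row j X | j in predC1 i1]
    <= lker (linfun (mulmxr c : 'rV[R]_n -> 'M[R]_1))}.
  move=> _ /mapP[j _ ->]; rewrite memv_ker lfunE /= mulmxBl -!row_mul Xc0.
  by rewrite !row0 subrr.
apply/matrixP => k z; rewrite ord1.
have : delta_mx 0 k \in lker (linfun (mulmxr c : 'rV[R]_n -> 'M[R]_1)).
  by apply: (subvP sub); rewrite Ufull memvf.
by rewrite memv_ker lfunE /= -rowE => /eqP/matrixP/(_ 0 0); rewrite !mxE.
Qed.

(** The rows themselves lie in the span of the differences: as they add up to 0,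
the row of i1 is the mean of its differences with all rows. *)
Lemma inj_span (N n : nat) (i1 : 'I_N) (X : 'M[R]_(N, n)) :
  \sum_i row i X = 0 -> (forall c : 'cV_n, X *m c = 0 -> c = 0) ->
  <<[seq row i1 X - row j X | j in predC1 i1]>>%VS = {: 'rV[R]_n}%VS.
Proof.
move=> X0 Xinj; set U := <<_>>%VS.
have diffU j : row i1 X - row j X \in U.
  have [->|ji] := eqVneq j i1; first by rewrite subrr mem0v.
  by apply/memv_span/mapP; exists j => //; rewrite mem_enum.
have row1U : row i1 X \in U.
  have N0 : (N%:R : R) != 0.
    by rewrite pnatr_eq0 -lt0n; case: (i1) => [? /= /(leq_trans _)]; apply.
  have -> : row i1 X = N%:R^-1 *: \sum_j (row i1 X - row j X).
    rewrite big_split /= sumr_const card_ord sumrN X0 subr0.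
    rewrite -[row i1 X *+ N]scaler_nat scalerA.
    by rewrite mulVf // scale1r.
  by apply/memvZ/memv_suml.
have rowU j : row j X \in U by rewrite -[row j X](subKr (row i1 X)) memvB.
have /row_freeP[B XB] : row_free X^T.
  apply: inj_row_free => v /(congr1 trmx); rewrite trmx_mul trmxK trmx0.
  by move=> /Xinj /(congr1 trmx); rewrite trmxK trmx0.
apply/eqP; rewrite eqEsubv subvf; apply/subvP => w _.
have -> : w = w *m B^T *m X by rewrite -mulmxA -(trmxK X) -trmx_mul XB trmx1 mulmx1.
by rewrite mulmx_sum_row; apply: memv_suml => j _; apply/memvZ/rowU.
Qed.

Lemma config_close_up (m n : nat) (X : 'M[R]_(m.+1, n)) :
  configuration_space R m.+1 n X ->
  exists2 Y : 'M[R]_(m, n), X = close_up Y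
    & forall c : 'cV_n, Y *m c = 0 -> c = 0.
Proof.
move=> [X0 _ Xspan].
pose Y : 'M[R]_(m, n) := \matrix_(i, b) X (lift ord_max i) b.
have XY : X = close_up Y.
  apply/matrixP => a b; case: (unliftP ord_max a) => [a'|] ->.
    by rewrite close_up_lift mxE.
  rewrite close_up_max; apply/eqP; rewrite -addr_eq0; apply/eqP.
  have Xb : \sum_i X i b = 0.
    have /matrixP/(_ 0 b) := X0; rewrite summxE [RHS]mxE => X0b.
    by rewrite -[RHS]X0b; apply: eq_bigr => i _; rewrite mxE.
  rewrite -[RHS]Xb sum_ord_lift addrC; congr (_ + _).
  by apply: eq_bigr => i _; rewrite mxE.
exists Y => // c Yc; apply: (span_inj (Xspan ord0 erefl)).
rewrite XY; apply/matrixP => a b; case: (unliftP ord_max a) => [a'|] ->.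
  have /matrixP/(_ a' b) := Yc; rewrite !mxE => Yca.
  by rewrite -[RHS]Yca; apply: eq_bigr => k _; rewrite close_up_lift.
rewrite !mxE; under eq_bigr do rewrite close_up_max mulNr mulr_suml.
rewrite sumrN exchange_big big1 ?oppr0 // => i _.
by have /matrixP/(_ i b) := Yc; rewrite !mxE.
Qed.

(** Points of the curve t |-> (t, t^2, ..., t^n), recentred. *)
Definition moment_curve (N n : nat) (t : 'I_N -> R) : 'M[R]_(N, n) :=
  \matrix_(i, k) (t i ^+ k.+1 - (\sum_a t a ^+ k.+1) / N%:R).

(** A column killed by this matrix lists the nonconstant coefficients of a
polynomial of degree at most n that vanishes at the N > n parameters. *)
Lemma moment_curve_config (N n : nat) (t : 'I_N -> R) :
  injective t -> (0 < n < N)%N ->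
  configuration_space R N n (moment_curve n t).
Proof.
move=> t_inj /andP[n0 nN].
have N0 : (N%:R : R) != 0 by rewrite pnatr_eq0 -lt0n (leq_trans _ nN).
have sum0 : \sum_i row i (moment_curve n t) = 0.
  apply/matrixP => z k; rewrite summxE mxE.
  under eq_bigr do rewrite !mxE.
  rewrite big_split /= sumrN sumr_const card_ord -[X in _ - X]mulr_natr.
  by rewrite divfK // subrr.
split=> // [i j ij|i1 _].
  apply: contraNneq ij => /matrixP/(_ 0 (Ordinal n0)).
  by rewrite !mxE /= !expr1 => /addIr/t_inj ->.
apply: inj_span => // c Xc.
pose q : {poly R} :=
  \sum_(k < n) c k 0 *: ('X^(k.+1) - ((\sum_a t a ^+ k.+1) / N%:R)%:P).
have coefq j : q`_j.+1 = \sum_(k < n) c k 0 * (j == k)%:R.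
  rewrite coef_sum; apply: eq_bigr => k _.
  by rewrite coefZ coefB coefXn coefC subr0 eqSS.
have q0 : q = 0.
  apply: (@roots_geq_poly_eq0 _ _ [seq t i | i <- enum 'I_N]).
  - apply/allP => _ /mapP[i _ ->]; apply/eqP.
    have /matrixP/(_ i 0) := Xc; rewrite !mxE => Xci.
    rewrite -[RHS]Xci horner_sum; apply: eq_bigr => k _.
    by rewrite !hornerE mxE mulrC.
  - by rewrite map_inj_uniq // enum_uniq.
  rewrite size_map size_enum_ord; apply: leq_trans nN; apply/leq_sizeP.
  move=> [//|j]; rewrite ltnS => nj; rewrite coefq big1 // => k _.
  by rewrite gtn_eqF ?mulr0 // (leq_trans (ltn_ord k)).
apply/matrixP => k z; rewrite ord1 mxE.
have := coefq k; rewrite q0 coef0 (bigD1 k) //= eqxx mulr1 big1 ?addr0 //.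
move=> l lk; rewrite (_ : (_ == _ :> nat) = false) ?mulr0 //.
by apply/negbTE; rewrite eq_sym.
Qed.

End Configurations.

(** * Steering along one edge *)

Section Steering.
Variables (R : realType) (N n : nat).
Implicit Types X Y : 'M[R]_(N, n).

Lemma Amx_mulE (i j : 'I_N) X l k :
  (Amx R i j *m X) l k = ((l == i)%:R - (l == j)%:R) * (X j k - X i k).
Proof.
have deltaE a b : (delta_mx a b *m X) l k = (l == a)%:R * X b k.
  rewrite mxE (bigD1 b) //= mxE eqxx andbT big1 ?addr0 // => z /negbTE zb.
  by rewrite mxE zb andbF mul0r.
have addE (A B C D : 'M[R]_(N, n)) :
    (A + B - C - D) l k = A l k + B l k - C l k - D l k by rewrite !mxE.
by rewrite /Amx !mulmxBl mulmxDl addE !deltaE; ring.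
Qed.

Lemma vector_fieldE (e : rel 'I_N) (u : 'I_N -> 'I_N -> R) X l k :
  vector_field e u X l k =
  \sum_(i : 'I_N) \sum_(j : 'I_N | (i < j)%N && e i j)
     u i j * (((l == i)%:R - (l == j)%:R) * (X j k - X i k)).
Proof.
rewrite summxE; apply: eq_bigr => i _; rewrite summxE; apply: eq_bigr => j _.
by rewrite mxE Amx_mulE.
Qed.

Definition edge_control (i j : 'I_N) (c : R) (a b : 'I_N) : R :=
  if (a == i) && (b == j) || (a == j) && (b == i) then c else 0.

Lemma vector_field_edge (e : rel 'I_N) (i j : 'I_N) (c : R) X l k :
  (i < j)%N -> e i j ->
  vector_field e (edge_control i j c) X l k =
  c * (((l == i)%:R - (l == j)%:R) * (X j k - X i k)).
Proof.
move=> ij eij; rewrite vector_fieldE (bigD1 i) //= (bigD1 j) /=; last first.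
  by rewrite ij.
rewrite {1}/edge_control !eqxx /= !big1 ?addr0 //.
- move=> a ai; apply: big1 => b /andP[ab _]; rewrite /edge_control (negbTE ai) /=.
  case: ifP => [/andP[/eqP aj /eqP bi]|_]; last by rewrite mul0r.
  by move: ab; rewrite aj bi ltnNge ltnW.
- move=> b /andP[/andP[ib _] bj]; rewrite /edge_control (negbTE bj) andbF /=.
  case: ifP => [/andP[_ /eqP bi]|_]; last by rewrite mul0r.
  by move: ib; rewrite bi ltnn.
Qed.

(** Along the flow x_i - x_j is exp (- 2 c (t - T)) times its value at T. *)
Lemma dilation_flow_derive (i j : 'I_N) (c T t : R) X l k : i != j ->
  is_derive t (1 : R)
    (fun t => dilation i j ((expR (- (2 * c) * (t - T)) - 1) / 2) X l k)
    (let Z := dilation i j ((expR (- (2 * c) * (t - T)) - 1) / 2) X in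
     c * (((l == i)%:R - (l == j)%:R) * (Z j k - Z i k))).
Proof.
move=> ij.
have Dexp : is_derive t (1 : R) (fun t => expR (- (2 * c) * (t - T)))
    (expR (- (2 * c) * (t - T)) * (- (2 * c))).
  apply: (@is_derive1_comp _ expR (fun t => - (2 * c) * (t - T))).
  have -> : (fun t => - (2 * c) * (t - T)) = (- (2 * c)) \*: (id - cst T) :> (R -> R).
    by apply/funext.
  by apply: is_derive_eq; rewrite subr0 [_ *: _]mulr1.
pose D : R := ((l == i)%:R - (l == j)%:R) * (X i k - X j k).
have -> : (fun t => dilation i j ((expR (- (2 * c) * (t - T)) - 1) / 2) X l k)
    = cst (X l k - D / 2) + (D / 2) \*: (fun t => expR (- (2 * c) * (t - T))).
  by apply/funext => x; rewrite mxE !fctE /= /D -[_ *: _]/(_ * _); field.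
apply: is_derive_eq.
rewrite /= !mxE !eqxx (negbTE ij) (eq_sym j i) (negbTE ij) /D.
by rewrite add0r -[_ *: _]/(_ * _) /=; field.
Qed.

Lemma steers_refl (e : rel 'I_N) X : steers e X X.
Proof.
exists 0, (fun _ _ _ => 0), (fun _ => X); split=> //.
  by split=> // i j; exists [::]; [split|].
split; first by move=> i k; apply: continuous_subspaceT => x; exact: cst_continuous.
by exists [::] => t /andP[t0 /(lt_trans t0)]; rewrite ltxx.
Qed.

Lemma append_piecewise_constant (T c : R) (f : R -> R) :
  piecewise_constant T f ->
  piecewise_constant (T + 1) (fun t => if t < T then f t else c).
Proof.
move=> [s sT sP]; exists (rcons s (T + 1)).
  rewrite -cats1; apply: itv_partition_cat sT _.
  by apply: itv_partition1; rewrite ltrDl.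
have sTl : nth 0 (0 :: s) (size s) = T := itv_partition_nth_size 0 sT.
move=> k; rewrite size_rcons ltnS leq_eqVlt => /orP[/eqP ->|ks].
  exists c => t; rewrite -rcons_cons nth_rcons /= ltnS leqnn sTl.
  by move=> /andP[Tt _]; rewrite ltNge ltW.
have [d dP] := sP k ks; exists d => t.
rewrite -rcons_cons !nth_rcons /= !ltnS ks (ltnW ks) => /andP[kt tk].
rewrite ifT; first by apply: dP; rewrite kt.
apply: lt_le_trans tk _; rewrite (set_nth_default T) //.
have := @itv_partition_nth_le _ _ 0 T s k.+1; exact.
Qed.

Lemma within_continuous_append (T : R) (f g : R -> R) : 0 <= T -> f T = g T ->
  {within `[0, T], continuous f} -> continuous g ->
  {within `[0, T + 1], continuous (fun t => if t <= T then f t else g t)}.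
Proof.
move=> T0 fgT fc gc.
have -> : `[0, T + 1]%classic = `[0, T] `|` `[T, T + 1].
  apply/seteqP; split => x /=; rewrite !in_itv /=.
    by move=> /andP[x0 x1]; case: (lerP x T) => xT; [left|right];
       rewrite ?x0 // ltW.
  by case=> /andP[x0 x1]; apply/andP; split; lra.
apply: withinU_continuous; [exact: interval_closed|exact: interval_closed| |].
  apply: subspace_eq_continuous fc => x.
  rewrite inE /= in_itv /= => /andP[_ xT].
  by rewrite /from_subspace xT.
apply: (@subspace_eq_continuous _ _ _ g); last exact: continuous_subspaceT.
move=> x; rewrite inE /= in_itv /= => /andP[Tx _].
rewrite /from_subspace; case: ifP => // xT.
by rewrite (_ : x = T) //; apply/eqP; rewrite eq_le xT.
Qed.

(** The dilation is appended as one more time interval of length 1, on which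
only the control of the edge ij is nonzero. *)
Lemma can_dilate_edge_lt (e : rel 'I_N) (i j : 'I_N) (s : R) X :
  (i < j)%N -> e i j -> - 2^-1 < s -> reach e X (dilation i j s X).
Proof.
move=> ij eij s0 X0 [T [u [Z [T0 [uC u_pc] [Zc [D ZD]] Z0 ZT]]]].
have nij : i != j by apply: contraTneq ij => ->; rewrite ltnn.
(* The value for which exp (- 2 c) is the ratio 1 + 2 s. *)
pose c := - (ln (1 + 2 * s) / 2).
pose flow t := dilation i j ((expR (- (2 * c) * (t - T)) - 1) / 2) X.
have flow_derive t l k : is_derive t (1 : R) (fun t => flow t l k)
    (vector_field e (edge_control i j c) (flow t) l k).
  by rewrite vector_field_edge //; exact: dilation_flow_derive.
have flowT : flow T = X.
  by apply/matrixP => l k; rewrite mxE subrr mulr0 expR0 subrr !mul0r addr0.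
have flowT1 : flow (T + 1) = dilation i j s X.
  rewrite /flow (_ : - (2 * c) * _ = ln (1 + 2 * s)); last by rewrite /c; field.
  rewrite lnK; first by congr dilation; field.
  by rewrite posrE; lra.
exists (T + 1), (fun a b t => if t < T then u a b t else edge_control i j c a b),
  (fun t => if t <= T then Z t else flow t); split.
- by rewrite addr_ge0.
- split=> a b; last exact: append_piecewise_constant.
  apply/funext => t; rewrite uC /edge_control orbC [(b == i) && _]andbC.
  by rewrite [(a == i) && _]andbC.
- split=> [l k|].
    have glue : Z T l k = flow T l k by rewrite ZT flowT.
    have flowc : continuous (fun t => flow t l k).
      move=> t; apply/differentiable_continuous/derivable1_diffP.
      by have [] := flow_derive t l k.
    rewrite (_ : (fun t => _ l k) =
      (fun t => if t <= T then Z t l k else flow t l k)).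
      exact: within_continuous_append.
    by apply/funext => t; case: ifP.
  exists (T :: D) => t /andP[t0 t1]; rewrite inE negb_or => /andP[tT tD] l k.
  have [ltT|] := ltP t T.
    rewrite ltW //; apply: near_eq_is_derive (ZD t _ tD l k); last first.
      by rewrite t0.
    near=> x; rewrite ifT //; apply: ltW; near: x; exact: lt_nbhsl.
  rewrite le_eqVlt eq_sym (negbTE tT) /= => ltT.
  rewrite leNgt ltT /=; apply: near_eq_is_derive (flow_derive t l k).
  near=> x; rewrite ifF //; apply/negbTE; rewrite -ltNge; near: x.
  exact: lt_nbhsr.
- by rewrite T0.
- by rewrite gerDl ler10 /= flowT1.
Unshelve. all: by end_near.
Qed.

End Steering.

Lemma can_dilate_edge (R : realType) (N : nat) (e : rel 'I_N) (i j : 'I_N) :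
  symmetric e -> i != j -> e i j -> can_dilate R e i j.
Proof.
move=> eC; rewrite neq_ltn => /orP[ij|ji] eij; last apply: can_dilateC;
  move=> n s X; apply: can_dilate_edge_lt => //; by rewrite eC.
Qed.

(** * Conservation of component sums *)

Section ConservedMoment.
Variable R : realType.

(** The mean value theorem between consecutive points of D. *)
Lemma derive0_off_finite (f : R -> R) (D : seq R) (a b : R) : a <= b ->
  {within `[a, b], continuous f} ->
  (forall t, a < t < b -> t \notin D -> is_derive t (1 : R) f 0) -> f a = f b.
Proof.
elim: D a b => [|d D IHD] a b ab fc fd.
  have df0 t : t \in `]a, b[%R -> is_derive t (1 : R) f ((fun=> 0) t).
    by rewrite in_itv /= => tab; exact: fd.
  have [t _ /eqP] := MVT_segment ab df0 fc.
  by rewrite mul0r subr_eq0 => /eqP.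
have [/andP[ad db]|dab] := boolP (a < d < b).
  transitivity (f d); first apply: (IHD a d (ltW ad)).
  - apply: continuous_subspaceW fc => x /=; rewrite !in_itv /=.
    by move=> /andP[-> xd]; rewrite (le_trans xd) // ltW.
  - move=> t /andP[at_ td] tD; apply: fd; first by rewrite at_ (lt_trans td).
    by rewrite inE negb_or tD lt_eqF.
  apply: (IHD d b (ltW db)).
  - apply: continuous_subspaceW fc => x /=; rewrite !in_itv /=.
    by move=> /andP[dx ->]; rewrite (le_trans _ dx) // ltW.
  - move=> t /andP[dt tb] tD; apply: fd; first by rewrite tb (lt_trans ad).
    by rewrite inE negb_or tD gt_eqF.
apply: IHD => // t tab tD; apply: fd => //; rewrite inE negb_or tD andbT.
by apply: contraNneq dab => <-.
Qed.

(** The term of an edge ab moves x_a and x_b by opposite amounts, and C contains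
both or neither. *)
Lemma steers_component_sum (N n : nat) (e : rel 'I_N) (C : pred 'I_N)
    (X0 X1 : 'M[R]_(N, n)) (k : 'I_n) :
  (forall i j, e i j -> C i = C j) -> steers e X0 X1 ->
  \sum_i (C i)%:R * X0 i k = \sum_i (C i)%:R * X1 i k.
Proof.
move=> Ce [T [u [Z [T0 _ [Zc [D ZD]] <- <-]]]].
pose f := \sum_(i < N) ((C i)%:R \*: (fun t => Z t i k)) : R -> R.
have fE t : f t = \sum_i (C i)%:R * Z t i k by rewrite /f fct_sumE.
rewrite -!fE; apply: (@derive0_off_finite f D) => //.
  rewrite /f; elim/big_ind: _ => [|g h gc hc|i _].
  - by apply: continuous_subspaceT => x; exact: cst_continuous.
  - by move=> x; apply: continuousD; [exact: gc|exact: hc].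
  - by move=> x; apply: continuousZr; exact: Zc.
move=> t tT tD; have fd i := is_deriveZ (C i)%:R (ZD t tT tD i k).
apply: is_derive_eq (is_derive_sum fd) _.
under eq_bigr do rewrite vector_fieldE scaler_sumr.
rewrite exchange_big big1 // => a _.
under eq_bigr do rewrite scaler_sumr.
rewrite exchange_big big1 // => b /andP[ab eab].
transitivity (u a b t * (Z t b k - Z t a k)
  * \sum_i ((C i)%:R * ((i == a)%:R - (i == b)%:R))).
  rewrite mulr_sumr; apply: eq_bigr => i _.
  by rewrite -[_ *: _]/(_ * _); ring.
under eq_bigr do rewrite mulrBr.
have sumC c : \sum_i (C i)%:R * (i == c)%:R = (C c)%:R :> R.
  rewrite (bigD1 c) //= eqxx mulr1 big1 ?addr0 // => i /negbTE ->.
  by rewrite mulr0.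
by rewrite big_split /= sumrN !sumC (Ce _ _ eab) subrr mulr0.
Qed.
End ConservedMoment.

(** * Connectedness and controllability *)

Lemma long_cycle_expE (N k : nat) (x : 'I_N) :
  (long_cycle N ^+ k)%g x = ((x + k) %% N)%N :> nat.
Proof.
elim: k => [|k IHk]; first by rewrite expg0 perm1 addn0 modn_small.
by rewrite expgSr permM permE /= IHk -addn1 modnDml addn1 addnS.
Qed.

Lemma porbit_long_cycle (N : nat) (x y : 'I_N) : y \in porbit (long_cycle N) x.
Proof.
apply/porbitP; exists (y + (N - x))%N; apply: val_inj.
rewrite [RHS]long_cycle_expE addnCA subnKC; last exact: ltnW.
by rewrite modnDr modn_small.
Qed.

(** The orbits of a star product form the finest partition in which the two ends
of each factor are together; for the edges of a graph these are the connected
components. *)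
Lemma iota_tilde_connected (R : realType) (N : nat) (e : rel 'I_N) :
  symmetric e -> irreflexive e ->
  iota_tilde (edge_matrices R e) = perm_class (long_cycle N) <->
  forall x y, connect e x y.
Proof.
move=> eC eI; rewrite /iota_tilde.
set ps := [seq _ <- _ | _].
have ps_edge p : (p \in ps) = (p.1 < p.2)%N && e p.1 p.2.
  rewrite mem_filter mem_enum andbT; case: ltnP => //= p12.
  apply/asboolP/idP => [[a [b [eab pab]]]|ep]; last by exists p.1, p.2.
  have ab : a != b by apply: contraTneq eab => ->; rewrite eI.
  have np : p.1 != p.2 by apply: contraTneq p12 => ->; rewrite ltnn.
  by have [[-> ->]//|[-> ->]] := Amx_inj np ab pab; rewrite eC.
split=> [iotaE x y|conn].
  have : star_prod ps \in perm_class (long_cycle N).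
    by rewrite -iotaE inE /same_orbits.
  rewrite inE /same_orbits => /eqP orbE.
  have /imsetP[z _ xz] : porbit (long_cycle N) x \in porbits (star_prod ps).
    by rewrite -orbE; apply/imsetP; exists x.
  have yx : y \in porbit (star_prod ps) x.
    have : x \in porbit (star_prod ps) z by rewrite -xz porbit_id.
    by rewrite -eq_porbit_mem => /eqP ->; rewrite -xz porbit_long_cycle.
  apply: (@star_prod_min _ (connect e)) yx.
  - exact: connect0.
  - exact: sym_connect_sym.
  - exact: connect_trans.
  - by move=> p; rewrite ps_edge => /andP[_ /connect1].
have orbT x y : y \in porbit (star_prod ps) x.
  have /connectP[q] := conn x y; elim: q x => [|z q IHq] x /=.
    by move=> _ ->; exact: porbit_id.
  move=> /andP[exz zq] yE.
  have /eqP <- : porbit (star_prod ps) z == porbit (star_prod ps) x.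
    rewrite eq_porbit_mem.
    have : x != z by apply: contraTneq exz => ->; rewrite eI.
    rewrite neq_ltn => /orP[xz|zx].
      by have := @star_prod_mem _ ps (x, z); rewrite ps_edge /= xz exz => ->.
    by rewrite porbit_sym; have := @star_prod_mem _ ps (z, x);
      rewrite ps_edge /= zx eC exz => ->.
  exact: IHq.
apply/setP => t; rewrite !inE /same_orbits; congr (_ == _).
apply: eq_imset => x; apply/setP => y.
by rewrite orbT porbit_long_cycle.
Qed.

Lemma can_dilate_connected (R : realType) (N : nat) (e : rel 'I_N) :
  symmetric e -> irreflexive e -> (forall x y, connect e x y) ->
  forall a b : 'I_N, a != b -> can_dilate R e a b.
Proof.
move=> eC eI conn a b; have /connectP[q] := conn a b.
elim/last_ind: q b => [|q c IHq] b /=; first by move=> _ ->; rewrite eqxx.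
rewrite rcons_path last_rcons => /andP[aq eqc] -> ac.
have qc : last a q != c by apply: contraTneq eqc => ->; rewrite eI.
have Dqc : can_dilate R e (last a q) c by exact: can_dilate_edge.
have [<-//|qa] := eqVneq (last a q) a.
apply: (can_dilate_trans _ qc ac _ Dqc); first by rewrite eq_sym.
by apply: IHq; rewrite // eq_sym.
Qed.

Lemma complete_dilations_controllable (R : realType) (m n : nat)
    (e : rel 'I_m.+1) :
  (n < m)%N -> (forall a b : 'I_m.+1, a != b -> can_dilate R e a b) ->
  controllable_on e (configuration_space R m.+1 n).
Proof.
move=> nm De X0 X1 /config_close_up[Y0 -> Y0i] /config_close_up[Y1 -> Y1i].
have [E E_el <-] := elementary_transitive nm Y0i Y1i.
suff H : reach e (close_up Y0) (close_up (E *m Y0)) by exact/H/steers_refl.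
elim: E_el => [|i l c E' il _ IHE]; first by rewrite mul1mx.
by apply: reach_trans IHE _; rewrite -mulmxA; exact: row_op_reach.
Qed.

(** Let C be the component of x.  The parameters i and i + N [i = x] give
two configurations whose first coordinates differ by N [i = x] - 1, as the
mean increases by 1.  Summing over C gives N - |C|, which must be 0 by
conservation, whereas y is not in C. *)
Lemma controllable_connected (R : realType) (N n : nat) (e : rel 'I_N) :
  symmetric e -> (0 < n < N)%N ->
  controllable_on e (configuration_space R N n) -> forall x y, connect e x y.
Proof.
move=> eC nN ctrl x y; apply/negPn/negP => nxy.
have [n0 n_lt] := andP nN.
have N0 : (N%:R : R) != 0 by rewrite pnatr_eq0 -lt0n (leq_trans _ n_lt).
(* Parameters i or i + N are distinct, being distinct modulo N. *)
pose t (h : 'I_N -> bool) (i : 'I_N) : R := (i + h i * N)%:R.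
have t_inj h : injective (t h).
  move=> i j /eqP; rewrite eqr_nat => /eqP /(congr1 (modn^~ N)).
  by rewrite ![(_ + _ * N)%N]addnC !modnMDl !modn_small // => /val_inj.
have /(steers_component_sum (Ordinal n0)) :=
  ctrl _ _ (moment_curve_config (t_inj (fun=> false)) nN)
           (moment_curve_config (t_inj (pred1 x)) nN).
move=> /(_ (connect e x)) /(_ _)/esym.
have Ce i j : e i j -> connect e x i = connect e x j.
  by move=> eij; apply: (same_connect_r (sym_connect_sym eC)); exact: connect1.
move=> /(_ Ce).
have tE i : t (pred1 x) i = t (fun=> false) i + (i == x)%:R * N%:R.
  by rewrite /t /= addn0 natrD natrM.
have sumx : \sum_i (i == x)%:R * N%:R = N%:R :> R.
  by rewrite -mulr_suml (bigD1 x) //= eqxx big1 ?addr0 ?mul1r // => i /negbTE ->.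
under eq_bigr => i _.
  rewrite (_ : moment_curve n _ i _ =
      moment_curve n (t (fun=> false)) i (Ordinal n0) + ((i == x)%:R * N%:R - 1)); last first.
    rewrite !mxE /= !expr1 tE; under eq_bigr do rewrite expr1 tE.
    rewrite big_split /= sumx; under [in RHS]eq_bigr do rewrite expr1.
    by field.
  rewrite mulrDr; over.
rewrite big_split /= => /eqP; rewrite -[X in _ == X]addr0 (inj_eq (addrI _)).
have -> : \sum_i (connect e x i)%:R * ((i == x)%:R * N%:R - 1) =
    \sum_i (1 - (connect e x i)%:R) :> R.
  under eq_bigr do rewrite mulrBr mulr1.
  rewrite !big_split /= sumr_const card_ord; congr (_ + _).
  rewrite -[RHS]sumx; apply: eq_bigr => i _; case: eqP => [->|_].
    by rewrite connect0 !mul1r.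
  by rewrite !mul0r mulr0.
rewrite psumr_eq0 => [/allP/(_ y (mem_index_enum y))|i _].
  by rewrite (negbTE nxy) subr0 oner_eq0.
by case: connect; rewrite /= ?subrr ?subr0 ?ler01.
Qed.

Theorem theorem5 (R : realType) (N n : nat) (e : rel 'I_N)
    (e_sym : symmetric e) (e_irr : irreflexive e)
    (n_gt0 : (0 < n)%N) (n_lt : (n.+1 < N)%N) :
  controllable_on e (configuration_space R N n) <->
  iota_tilde (edge_matrices R e) = perm_class (long_cycle N).
Proof.
rewrite iota_tilde_connected //; split.
  by apply: controllable_connected => //; rewrite n_gt0 ltnW.
case: N n_lt e e_sym e_irr => // m n_lt e e_sym e_irr conn.
by apply: complete_dilations_controllable => //; exact: can_dilate_connected.
Qed.
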